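(* Let $n \ge 4$ be an integer and let $M^{(n)}$ be the $n\times n$ real matrix with entries $$M^{(n)}_{ij} = \begin{cases} 1, & \text{if } -2 \le j-i \le 1,\\ 1, & \text{if } (i,j)=(1,n-1) \text{ or } (i,j)=(2,n),\\ 0, & \text{otherwise},\end{cases}$$ and let $M_n=\det M^{(n)}$. Then $$M_n=\begin{cases} 0, & n\equiv 0 \pmod 4,\\ 2, & n\equiv 1 \pmod 4,\\ 3, & n\equiv 2 \pmod 4,\\ 1, & n\equiv 3 \pmod 4.\end{cases}$$
   Context: $M^{(n)}$ is the Toeplitz matrix whose first superdiagonal, main diagonal and first two subdiagonals consist of ones, with additional ones at positions $(1,n-1)$ and $(2,n)$ (so the entry $(1,n)$ is $0$), and zeros elsewhere. *)

(* Defs.v *)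
From HB Require Import structures.
From mathcomp Require Import all_boot all_order all_algebra.
From mathcomp Require Import reals.
Set Implicit Arguments.
Unset Strict Implicit.
Unset Printing Implicit Defensive.
Import Order.TTheory GRing.Theory Num.Theory.
Local Open Scope ring_scope.

(* The row and column indices i, j of [Mentry] are 1-based. *)
Definition Mentry (R : realType) (n i j : nat) : R :=
  if (-2 <= j%:Z - i%:Z) && (j%:Z - i%:Z <= 1) then 1
  else if ((i, j) == (1, n - 1)%N) || ((i, j) == (2, n)%N) then 1
  else 0.

Definition Mmx (R : realType) (n : nat) : 'M[R]_n :=
  \matrix_(i < n, j < n) Mentry R n i.+1 j.+1.

(* Main.v *)
(* Rows 3, ..., n-1 of M kill every 4-periodic vector with zero sum over a
   period.  Multiply M on the right by the unitriangular matrix K whose first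
   three columns span these vectors and whose other columns are those of the
   identity, and move the last row up to the third position: the result is block
   upper triangular, with a lower unitriangular lower right block.  Hence det M
   is, up to the sign (-1)^(n-3), the determinant of a 3x3 matrix which only
   depends on n mod 4. *)
Require Import Defs.
From mathcomp Require Import all_boot all_order all_algebra all_fingroup.
From mathcomp Require Import reals.
From mathcomp Require Import zify ring.
Import Order.TTheory GRing.Theory Num.Theory.
Local Open Scope ring_scope.

(** Entries come from a function on [nat], so that the expanded formula has numerals as indices and
    [corner] can then be evaluated by computation. *)
Lemma det_mx33 (R : comNzRingType) (A : 'M[R]_3) (a : nat -> nat -> R) :
    (forall i j : 'I_3, A i j = a i j) ->
  \det A = a 0 0 * (a 1 1 * a 2 2 - a 1 2 * a 2 1)
         - a 0 1 * (a 1 0 * a 2 2 - a 1 2 * a 2 0)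
         + a 0 2 * (a 1 0 * a 2 1 - a 1 1 * a 2 0).
Proof.
have det2 (B : 'M[R]_2) :
    \det B = B ord0 ord0 * B ord_max ord_max - B ord0 ord_max * B ord_max ord0.
  rewrite (expand_det_row _ ord0) !big_ord_recl big_ord0 /cofactor !det_mx11 !mxE /=.
  have -> : lift ord0 ord0 = ord_max :> 'I_2 by apply: val_inj.
  have -> : lift ord_max 0 = 0 :> 'I_2 by apply: val_inj.
  by rewrite /= /bump /=; ring.
move=> E; rewrite (expand_det_row _ ord0) !big_ord_recl big_ord0 /cofactor.
by rewrite !det2 !mxE !E /= /bump /=; ring.
Qed.

Lemma sum_delta (R : pzSemiRingType) (n a : nat) (F : nat -> R) : (a < n)%N ->
  \sum_(k < n) (k == a :> nat)%:R * F k = F a.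
Proof.
move=> lt_an; rewrite (bigD1 (Ordinal lt_an)) //= eqxx mul1r big1 ?addr0 // => k.
by rewrite -val_eqE /= => /negbTE ->; rewrite mul0r.
Qed.

Lemma MentryE (R : realType) (n i j : nat) :
  Mentry R n i j = [|| (j <= i.+1) && (i <= j.+2), (i == 1) && (j == n - 1)
                     | (i == 2) && (j == n)]%N%:R.
Proof.
rewrite /Mentry !xpair_eqE orbA.
have -> : (-2 <= j%:Z - i%:Z) && (j%:Z - i%:Z <= 1) = (j <= i.+1)%N && (i <= j.+2)%N by lia.
by case: (_ && _) => //=; case: (_ || _).
Qed.

Section Rows.
Variables (R : realType) (n : nat) (F : nat -> R).
Hypothesis hn : (4 <= n)%N.

Let row i := \sum_(k < n) Mentry R n i.+1 k.+1 * F k.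

Lemma Mrow_first : row 0 = F 0 + F 1 + F (n - 2)%N.
Proof.
(* Each value of [F] on the right becomes a sum of deltas, so it suffices to compare the
   coefficients of [F k], which are natural numbers. As [4 <= n], the two extra ones lie outside the
   band. *)
rewrite /row -!(@sum_delta _ n _ F) -?big_split /=; try lia.
apply: eq_bigr => k _; rewrite -!mulrDl; congr (_ * _); rewrite MentryE -!natrD.
by congr _%:R; have := ltn_ord k; lia.
Qed.

Lemma Mrow_second : row 1 = F 0 + F 1 + F 2 + F n.-1.
Proof.
rewrite /row -!(@sum_delta _ n _ F) -?big_split /=; try lia.
apply: eq_bigr => k _; rewrite -!mulrDl; congr (_ * _); rewrite MentryE -!natrD.
by congr _%:R; have := ltn_ord k; lia.
Qed.

Lemma Mrow_mid i : (i.+3 < n)%N -> row i.+2 = F i + F i.+1 + F i.+2 + F i.+3.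
Proof.
move=> hi; rewrite /row -!(@sum_delta _ n _ F) -?big_split /=; try lia.
apply: eq_bigr => k _; rewrite -!mulrDl; congr (_ * _); rewrite MentryE -!natrD.
by congr _%:R; have := ltn_ord k; lia.
Qed.

Lemma Mrow_last : row n.-1 = F (n - 3)%N + F (n - 2)%N + F n.-1.
Proof.
rewrite /row -!(@sum_delta _ n _ F) -?big_split /=; try lia.
apply: eq_bigr => k _; rewrite -!mulrDl; congr (_ * _); rewrite MentryE -!natrD.
by congr _%:R; have := ltn_ord k; lia.
Qed.
End Rows.

(* Entry of the matrix K of the header, with 0-based indices. *)
Definition Kentry (R : realType) (k j : nat) : R :=
  if (j < 3)%N then (k %% 4 == j)%N%:R - (k %% 4 == 3)%N%:R else (k == j)%:R.

(** Four consecutive integers meet each residue class mod 4 once, so both indicators in [Kentry] sum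
    to 1 and cancel. *)
Lemma Kentry_sum4 (R : realType) (k j : nat) : (j < 3)%N ->
  Kentry R k j + Kentry R k.+1 j + Kentry R k.+2 j + Kentry R k.+3 j = 0.
Proof.
have sum1 r : (r < 4)%N ->
    (k %% 4 == r)%N%:R + (k.+1 %% 4 == r)%N%:R + (k.+2 %% 4 == r)%N%:R
    + (k.+3 %% 4 == r)%N%:R = 1 :> R.
  by move=> ?; rewrite -!natrD -[RHS]/1%:R; congr _%:R; lia.
move=> j3; rewrite /Kentry j3 -[RHS](subrr 1).
rewrite -[X in _ = X - _](sum1 j (ltnW j3)) -[X in _ = _ - X](sum1 3%N isT).
ring.
Qed.

(* Rows 1, 2 and n (counted from 1) of M applied to the first three columns of K. *)
Definition corner (R : realType) (n i j : nat) : R :=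
  let f k := Kentry R k j in
  match i with
  | 0%N => f 0%N + f 1%N + f (n - 2)%N
  | 1%N => f 0%N + f 1%N + f 2%N + f n.-1
  | _ => f (n - 3)%N + f (n - 2)%N + f n.-1
  end.

Lemma det_Mmx_corner (R : realType) (m : nat) : (0 < m)%N ->
  \det (Mmx R m.+3) = (-1) ^+ m * \det (\matrix_(i < 3, j < 3) corner R m.+3 i j).
Proof.
move=> m_gt0.
pose K : 'M[R]_(m.+3) := \matrix_(k, j) Kentry R k j.
have detK : \det K = 1.
  rewrite det_trig.
    rewrite big1 // => i _; rewrite mxE /Kentry eqxx; case: ifP => // ?.
    have [-> ->] : (i %% 4 == i)%N = true /\ (i %% 4 == 3)%N = false by lia.
    exact: subr0.
  apply/is_trig_mxP => i j lt_ij; rewrite mxE /Kentry; case: ifP => ?.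
    have [-> ->] : (i %% 4 == j)%N = false /\ (i %% 4 == 3)%N = false by lia.
    exact: subr0.
  by rewrite (_ : (_ == _) = false) //; lia.
have v2 : (inord 2 : 'I_m.+3) = 2%N :> nat by rewrite inordK.
(* Row [i] of the permuted matrix is row [s i] of M: the last row lands at 0-based position 2, and
   the rows from there on move down by one. *)
pose s : 'S_m.+3 := lift_perm (inord 2) ord_max 1%g.
have sE (i : 'I_m.+3) :
    s i = (if i < 2 then val i else if i == 2 :> nat then m.+2 else i.-1)%N :> nat.
  case: (unliftP (inord 2) i) => [k|] ->; rewrite /s.
    rewrite lift_perm_lift perm1 lift_max /= /bump v2.
    by case: ltnP => /= ?; do ?case: ifP => ? //; lia.
  by rewrite lift_perm_id v2.
pose N : 'M[R]_(3 + m) := row_perm s (Mmx R m.+3) *m K.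
have NE i j : N i j = \sum_(k < m.+3) Mentry R m.+3 (s i).+1 k.+1 * Kentry R k j.
  by rewrite mxE; apply: eq_bigr => k _; rewrite !mxE.
have Nlow (a : 'I_m) (j : 'I_(3 + m)) :
    N (rshift 3 a) j = Kentry R a j + Kentry R a.+1 j + Kentry R a.+2 j + Kentry R a.+3 j.
  rewrite NE sE -(@Mrow_mid R m.+3 (fun k => Kentry R k j)) //; last by move: (ltn_ord a); lia.
have detN : \det N = \det (\matrix_(i < 3, j < 3) corner R m.+3 i j).
  have -> : N = block_mx (ulsubmx N) (ursubmx N) 0 (drsubmx N).
    rewrite -[LHS]submxK; congr block_mx; apply/matrixP => a j.
    rewrite [LHS]mxE [LHS]mxE Nlow Kentry_sum4 ?mxE /=; [by [] | exact: ltn_ord].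
  (* Column [3 + j] of K is a unit vector, and row [3 + a] of N sums its entries [a] to [a + 3]:
     this window reaches the diagonal but never passes it. *)
  rewrite det_ublock (det_trig (A := drsubmx N)); last first.
    apply/is_trig_mxP => i j lt_ij; rewrite [LHS]mxE [LHS]mxE Nlow /Kentry /=.
    by rewrite -!natrD -[RHS]/0%:R; congr _%:R; lia.
  rewrite [X in _ * X]big1 => [|i _]; last first.
    rewrite [LHS]mxE [LHS]mxE Nlow /Kentry /=.
    by rewrite -!natrD -[RHS]/1%:R; congr _%:R; lia.
  rewrite mulr1; congr (\det _); apply/matrixP => i j.
  rewrite [LHS]mxE [LHS]mxE NE sE [RHS]mxE /=.
  case: i => [[|[|[|//]]] /= _].
  - by rewrite (@Mrow_first R m.+3 (fun k => Kentry R k j)).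
  - by rewrite (@Mrow_second R m.+3 (fun k => Kentry R k j)).
  - by rewrite (@Mrow_last R m.+3 (fun k => Kentry R k j)).
have : \det N = (-1) ^+ m * \det (Mmx R m.+3).
  (* The parity of [s] is that of [2 + (m + 2)], the sum of the lifted index and its image. *)
  rewrite det_mulmx detK mulr1 row_permE det_mulmx det_perm odd_lift_perm odd_perm1 /=.
  by rewrite v2 addbF /= negbK signr_odd.
by rewrite detN => ->; rewrite mulrA -exprD addnn -mul2n exprM sqrrN expr1n expr1n mul1r.
Qed.

Theorem theorem2 (R : realType) (n : nat) (hn : (4 <= n)%N) :
  [/\ (n = 0 %[mod 4])%N -> \det (Mmx R n) = 0,
      (n = 1 %[mod 4])%N -> \det (Mmx R n) = 2,
      (n = 2 %[mod 4])%N -> \det (Mmx R n) = 3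
    & (n = 3 %[mod 4])%N -> \det (Mmx R n) = 1].
Proof.
case: n hn => [|[|[|m]]] // hn; rewrite det_Mmx_corner //.
rewrite (@det_mx33 _ _ (corner R m.+3)); last by move=> i j; rewrite mxE.
rewrite -signr_odd /corner /Kentry /=.
split=> hm.
(* The residue of [n = m + 3] mod 4 fixes the sign and every indicator in [corner], leaving a
   numerical determinant. *)
- have [-> -> -> ->] : [/\ odd m = true, (m.+3 - 2) %% 4 = 2, (m.+3 - 3) %% 4 = 1
    & m.+2 %% 4 = 3]%N by split; lia.
  by rewrite /=; ring.
- have [-> -> -> ->] : [/\ odd m = false, (m.+3 - 2) %% 4 = 3, (m.+3 - 3) %% 4 = 2
    & m.+2 %% 4 = 0]%N by split; lia.
  by rewrite /=; ring.
- have [-> -> -> ->] : [/\ odd m = true, (m.+3 - 2) %% 4 = 0, (m.+3 - 3) %% 4 = 3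
    & m.+2 %% 4 = 1]%N by split; lia.
  by rewrite /=; ring.
- have [-> -> -> ->] : [/\ odd m = false, (m.+3 - 2) %% 4 = 1, (m.+3 - 3) %% 4 = 0
    & m.+2 %% 4 = 2]%N by split; lia.
  by rewrite /=; ring.
Qed.
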